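(* For all $n\ge 3$, the number of permutations $\sigma\in S_n(231)$ with $\mathrm{maxdrop}(\sigma)=2$ and $\mathrm{des}(\sigma)=2$ equals $\binom{n+1}{4}$.
   Context: For a permutation $\sigma=\sigma_1\cdots\sigma_n$ of $[n]$, $\mathrm{des}(\sigma)$ is the number of $i\in[n-1]$ with $\sigma_i>\sigma_{i+1}$, and $\mathrm{maxdrop}(\sigma)=\max\{i-\sigma_i : i\in[n]\}$. $S_n(231)$ is the set of permutations of $[n]$ with no indices $a<b<c$ such that $\sigma_c<\sigma_a<\sigma_b$. *)

(* Defs.v *)
From mathcomp Require Import all_boot all_fingroup.
Set Implicit Arguments.
Unset Strict Implicit.
Unset Printing Implicit Defensive.

(* A permutation of [n] is s : 'S_n, with positions and values shifted from
   {1, ..., n} to {0, ..., n-1}; des, maxdrop and pattern avoidance only involve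
   comparisons and differences, so they are unaffected by the shift. *)

Definition des (n : nat) (s : 'S_n) : nat :=
  #|[set i : 'I_n | [exists j : 'I_n, (j == i.+1 :> nat) && (s j < s i)]]|.

(* The subtraction is truncated, which does not change the maximum for n > 0:
   the last position always satisfies s i <= i, so the integer maximum of
   i - s i is nonnegative. *)
Definition maxdrop (n : nat) (s : 'S_n) : nat := \max_(i < n) (i - s i).

Definition avoids231 (n : nat) (s : 'S_n) : bool :=
  ~~ [exists a : 'I_n, exists b : 'I_n, exists c : 'I_n,
        [&& a < b, b < c, s c < s a & s a < s b]].

(* Main.v *)
Require Import Defs.
From mathcomp Require Import all_boot all_fingroup.
From mathcomp Require Import zify.

(* In a 231-avoiding s, a position t that is not a descent carries a
   right-to-left minimum: otherwise t, t+1 and the place of a smaller later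
   value form a 231 pattern.  So s t is the least value not used before t, and
   s is determined by its descents and the values there.  With exactly two
   descents p < q this greedy rule produces the composite of two cycles
   [cyc p l] after [cyc q k].  Among these, maxdrop = 2 forces q <= l,
   and then avoidance forces k <= l; conversely every choice
   p < q < k <= l < n works.  Such quadruples are the 4-subsets
   {p, q, k, l+1} of {0, ..., n}. *)

(** * Cycles on intervals of natural numbers *)

(* The cycle a -> b -> b-1 -> ... -> a; it is the identity when b < a. *)
Definition cyc a b t :=
  if (t < a) || (b < t) then t else if t == a then b else t.-1.

Definition cyc_inv a b u :=
  if (u < a) || (b < u) then u else if u == b then a else u.+1.

Variant cyc_spec a b t : nat -> Prop :=
  | CycFixed of (t < a) || (b < t) : cyc_spec a b t t
  | CycStart of t = a /\ a <= b : cyc_spec a b t b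
  | CycShift of a < t <= b : cyc_spec a b t t.-1.

Lemma cycP a b t : cyc_spec a b t (cyc a b t).
Proof.
by rewrite /cyc; case: ifP => [|?]; [|case: eqP]; constructor; lia.
Qed.

Variant cyc_inv_spec a b u : nat -> Prop :=
  | CycInvFixed of (u < a) || (b < u) : cyc_inv_spec a b u u
  | CycInvEnd of u = b /\ a <= b : cyc_inv_spec a b u a
  | CycInvShift of a <= u < b : cyc_inv_spec a b u u.+1.

Lemma cyc_invP a b u : cyc_inv_spec a b u (cyc_inv a b u).
Proof.
by rewrite /cyc_inv; case: ifP => [|?]; [|case: eqP]; constructor; lia.
Qed.

(* Innermost applications are split first, so that no case condition mentions
   another cycle; pruning after each split avoids an exponential blow-up. *)
Ltac cyc_lia :=
  rewrite /=;
  repeat match goal with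
  | |- context [cyc ?a ?b ?t] =>
    lazymatch t with context [cyc] => fail | context [cyc_inv] => fail
    | _ => case: (cycP a b t) => ?; try lia end
  | |- context [cyc_inv ?a ?b ?t] =>
    lazymatch t with context [cyc] => fail | context [cyc_inv] => fail
    | _ => case: (cyc_invP a b t) => ?; try lia end
  end; try lia.

Lemma cycK a b : cancel (cyc a b) (cyc_inv a b).
Proof. by move=> t; cyc_lia. Qed.

Lemma cyc_invK a b : cancel (cyc_inv a b) (cyc a b).
Proof. by move=> t; cyc_lia. Qed.

Lemma cyc_lt a b n t : b < n -> t < n -> cyc a b t < n.
Proof. by cyc_lia. Qed.

Lemma cyc_inv_lt a b n t : b < n -> t < n -> cyc_inv a b t < n.
Proof. by cyc_lia. Qed.

(* The second alternative says that f t is a right-to-left minimum and that all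
   values below g t are taken by g before t, so f t must be g t. *)
Lemma eq_of_greedy n m (f g h : nat -> nat) :
  (forall u, u < n -> exists2 c, c < n & f c = u) ->
  (forall t u, t < n -> u < n -> f t = f u -> t = u) ->
  cancel g h -> cancel h g -> (forall t, t < n -> g t < n) -> m <= n ->
  (forall t, t < m -> f t = g t \/
     (forall c, t < c < n -> f t < f c) /\ (forall u, u < g t -> h u < t)) ->
  forall t, t < m -> f t = g t.
Proof.
move=> fsurj finj gK hK gn lemn fP; elim/ltn_ind => t IH ltm.
case: (fP t ltm) => // -[fmin hmin].
have ltn : t < n by lia.
have [c cn fc] := fsurj _ (gn t ltn).
case: (ltngtP c t) => [ct|tc|ct]; last by rewrite -fc ct.
  by move: fc; rewrite (IH c) //; [move=> /(can_inj gK)|]; lia.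
have := fmin c; rewrite tc cn fc => /(_ isT) /hmin ht.
have /finj e : f (h (f t)) = f t by rewrite IH ?hK //; lia.
by move: e; lia.
Qed.

(** * Permutations as functions on natural numbers *)

Section NatPerm.
Variables (n : nat) (s : 'S_n).

(* Extends s by the identity outside {0, ..., n-1}. *)
Definition natfun t := oapp (fun x => nat_of_ord (s x)) t (insub t).

Lemma natfunE (x : 'I_n) : natfun x = s x.
Proof. by rewrite /natfun valK. Qed.

Lemma natfun_surj u : u < n -> exists2 c, c < n & natfun c = u.
Proof.
by move=> un; exists ((s^-1)%g (Ordinal un)); rewrite ?natfunE ?permKV.
Qed.

Lemma natfun_lt t : t < n -> natfun t < n.
Proof. by move=> tn; rewrite (natfunE (Ordinal tn)). Qed.

Lemma natfun_inj t u : t < n -> u < n -> natfun t = natfun u -> t = u.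
Proof.
move=> tn un; rewrite (natfunE (Ordinal tn)) (natfunE (Ordinal un)).
by move=> /val_inj /perm_inj [].
Qed.

Lemma avoids231P :
  reflect (forall a b c, a < b -> b < c -> c < n ->
             ~ (natfun c < natfun a < natfun b)) (avoids231 s).
Proof.
apply: (iffP idP) => [/existsP av a b c ab bc cn lt|av].
  have bn := ltn_trans bc cn; have an := ltn_trans ab bn.
  apply: av; exists (Ordinal an); apply/existsP; exists (Ordinal bn).
  apply/existsP; exists (Ordinal cn).
  by rewrite ab bc -!natfunE.
apply/negP => /existsP[a /existsP[b /existsP[c /and4P[ab bc ca lab]]]].
by apply: (av a b c) => //; rewrite !natfunE ca.
Qed.

Lemma maxdrop_eqP m :
  0 < m -> reflect ((forall t, t < n -> t - natfun t <= m) /\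
            (exists2 t, t < n & t - natfun t = m)) (maxdrop s == m).
Proof.
move=> m_gt0; apply: (iffP eqP) => [mE|[ub [t tn tm]]].
  split=> [t tn|].
    by rewrite -mE (natfunE (Ordinal tn)) (leq_bigmax (Ordinal tn)).
  (* For n = 0 the maximum is empty, hence 0, against m > 0. *)
  have n_gt0 : 0 < #|'I_n|.
    rewrite card_ord lt0n; apply: contraTneq m_gt0 => n0.
    rewrite -mE /maxdrop big1 // => x _; have := ltn_ord x; lia.
  have [x xE] := eq_bigmax (fun i : 'I_n => i - s i) n_gt0.
  by exists x; rewrite // natfunE -xE.
apply/eqP; rewrite eqn_leq; apply/andP; split.
  by apply/bigmax_leqP => x _; rewrite -natfunE ub.
by rewrite -tm (natfunE (Ordinal tn)) (leq_bigmax (Ordinal tn)).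
Qed.

Definition descents :=
  [set i : 'I_n | [exists j : 'I_n, (j == i.+1 :> nat) && (s j < s i)]].

Lemma mem_descents (x : 'I_n) :
  (x \in descents) = (x.+1 < n) && (natfun x.+1 < natfun x).
Proof.
rewrite inE; apply/existsP/andP => [[j /andP[/eqP <-]]|[xn lt]].
  by rewrite !natfunE.
by exists (Ordinal xn); rewrite eqxx -!natfunE.
Qed.

Lemma avoids231_nondescent t c :
  avoids231 s -> t < c -> c < n -> natfun t <= natfun t.+1 ->
  natfun t < natfun c.
Proof.
move=> /avoids231P av tc cn le.
have [eqc|neqc] := eqVneq t.+1 c.
  subst c; have := @natfun_inj t t.+1; lia.
have := @natfun_inj t t.+1; have := @natfun_inj t c.
by have := av t t.+1 c; lia.
Qed.

(** The greedy comparison runs three times: with the identity before p, with [cyc p l] before q,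
    then with the composite everywhere. The value at p is l; the value at q, pulled back through
    [cyc p l], is k. *)
Lemma two_descents_cyc p q :
  avoids231 s -> p < q -> q < n -> natfun p.+1 < natfun p ->
  q.+1 < n -> natfun q.+1 < natfun q ->
  (forall t, t < n -> t != p -> t != q -> natfun t <= natfun t.+1) ->
  exists k l, [/\ p < l < n, q < k < n &
    forall t, t < n -> natfun t = cyc p l (cyc q k t)].
Proof.
move=> av pq qn dp q1n dq nd.
have ndP t c : t != p -> t != q -> t < c < n -> natfun t < natfun c.
  move=> tp tq /andP[tc cn]; apply: avoids231_nondescent => //.
  by apply: nd => //; lia.
have gr := eq_of_greedy n _ natfun _ _ natfun_surj natfun_inj.
have f1 t : t < p -> natfun t = t.
  apply: (gr p id id) => //; first by lia.
  by move=> u up; right; split=> // c; apply: ndP; lia.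
pose l := natfun p.
have ln : l < n by apply: natfun_lt; lia.
have pl : p < l.
  (* Values below p are used up before p, so p and p+1 carry values at least p, and the descent at p
     makes l exceed p. *)
  have P u : u < p -> natfun p <> u /\ natfun p.+1 <> u.
    move=> up; split=> e; [have := @natfun_inj p u|have := @natfun_inj p.+1 u];
      rewrite (f1 u) //; lia.
  by have := P (natfun p); have := P (natfun p.+1); rewrite /l; lia.
have f2 t : t < q -> natfun t = cyc p l t.
  apply: (gr q _ (cyc_inv p l)); first exact: cycK.
  - exact: cyc_invK.
  - by move=> u; apply: cyc_lt.
  - by lia.
  move=> u uq; have [->|up] := eqVneq u p; first by left; rewrite -/l; cyc_lia.
  right; split=> [c|w]; first by apply: ndP; lia.
  by cyc_lia.
pose k := cyc_inv p l (natfun q).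
have kn : k < n by apply: cyc_inv_lt => //; apply: natfun_lt; lia.
have fk : natfun q = cyc p l k by rewrite cyc_invK.
have qk : q < k.
  (* Likewise both preimages under [cyc p l] are at least q. As [cyc p l] is increasing past p, the
     descent at q puts k strictly above the other one. *)
  have P u : u < q -> natfun q <> cyc p l u /\ natfun q.+1 <> cyc p l u.
    move=> uq; rewrite -f2 //; split=> e;
    [have := @natfun_inj q u|have := @natfun_inj q.+1 u]; lia.
  have := P k; rewrite fk.
  have := P (cyc_inv p l (natfun q.+1)); rewrite cyc_invK.
  move: dq; rewrite fk.
  move: (natfun q.+1) (k) => y z.
  by cyc_lia.
exists k, l; split; [lia|lia|].
apply: (gr n _ (cyc_inv q k \o cyc_inv p l)) => //.
- by apply: (can_comp (cycK p l) (cycK q k)).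
- by apply: (can_comp (cyc_invK q k) (cyc_invK p l)).
- by move=> u un; do 2!apply: cyc_lt => //.
move=> u un; case: (ltngtP u q) => [uq|qu|->].
- by left; rewrite f2 //; congr cyc; rewrite {1}/cyc uq.
- right; split=> [c|w]; first by apply: ndP; lia.
  by cyc_lia.
- by left; rewrite fk; congr cyc; cyc_lia.
Qed.

Lemma two_descents_maxdrop2_params :
  [&& avoids231 s, maxdrop s == 2 & des s == 2] ->
  exists p q k l, [/\ p < q, q < k, k <= l, l < n &
    forall t, t < n -> natfun t = cyc p l (cyc q k t)].
Proof.
move=> /and3P[av /maxdrop_eqP[//|_ [t tn td]] des2].
have /cards2P[x [y [xy D]]] : #|descents| == 2 by exact: des2.
wlog ltxy : x y xy D / x < y.
  move=> W; case: (ltngtP x y) => [|lt|e]; first exact: W.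
    by apply: (W y x) => //; rewrite 1?eq_sym // D setUC.
  by case/eqP: xy; apply: val_inj.
have := mem_descents x; rewrite D !inE eqxx => /esym /andP[x1 dx].
have := mem_descents y; rewrite D !inE eqxx orbT => /esym /andP[y1 dy].
have nd u : u < n -> u != x -> u != y -> natfun u <= natfun u.+1.
  move=> un ux uy; have := mem_descents (Ordinal un).
  rewrite D !inE -!val_eqE /= (negPf ux) (negPf uy) /=.
  have [u1|u1] := ltnP u.+1 n; first by lia.
  (* Here u is n-1, and [natfun] is the identity from n on, so the last position is no descent. *)
  have -> : natfun u.+1 = u.+1 by rewrite /natfun insubF // ltnNge u1.
  by have := natfun_lt u un; lia.
have [k [l [pl qk fE]]] :=
  two_descents_cyc x y av ltxy (ltn_ord y) dx y1 dy nd.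
exists x, y, k, l; split=> //; try lia.
(* If l < y, the two cycles have disjoint supports and no drop exceeds 1. *)
have yl : y <= l by move: td; rewrite fE //; cyc_lia.
(* The values at x, y, y+1 would be l, k, y-1 if l < k, a 231 pattern. *)
have /avoids231P/(_ x y y.+1 ltxy (ltnSn _) y1) := av.
by rewrite !fE ?ltn_ord //; cyc_lia.
Qed.

(** Only positions p and q fail to carry right-to-left minima. A 231 pattern would need them as its
    first two entries, but their values l > k-1 decrease. Drops equal 2 exactly on q+1, ..., k. *)
Lemma two_descents_maxdrop2_of_params p q k l :
  p < q -> q < k -> k <= l -> l < n ->
  (forall t, t < n -> natfun t = cyc p l (cyc q k t)) ->
  [&& avoids231 s, maxdrop s == 2 & des s == 2].
Proof.
move=> pq qk kl ln fE; apply/and3P; split.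
- apply/avoids231P => a b c ab bc cn; rewrite !fE; try lia.
  by cyc_lia.
- apply/maxdrop_eqP => //; split=> [t tn|]; first by rewrite fE //; cyc_lia.
  by exists q.+1; [lia|rewrite fE; cyc_lia].
have pn : p < n by lia.
have qn : q < n by lia.
change (#|descents| == 2).
suff -> : descents = [set Ordinal pn; Ordinal qn].
  by rewrite cards2 -val_eqE /= (ltn_eqF pq).
apply/setP => x; rewrite mem_descents !inE -!val_eqE /=.
have xn := ltn_ord x.
have [x1|x1] := ltnP x.+1 n; last by lia.
by rewrite !fE //; cyc_lia.
Qed.

End NatPerm.

(** * Permutations built from the parameters, and the count *)

Section CycPerm.
Variable n : nat.

(* The cap n.-1 only serves to make the permutation total in b. *)
Fact cyc_ord_subproof a b (x : 'I_n) : cyc a (minn b n.-1) x < n.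
Proof. by apply: cyc_lt => //; have := ltn_ord x; lia. Qed.

Definition cyc_ord a b (x : 'I_n) : 'I_n := Ordinal (cyc_ord_subproof a b x).

Lemma cyc_ord_inj a b : injective (cyc_ord a b).
Proof. by move=> x y [] /(can_inj (cycK _ _)) /val_inj. Qed.

Definition cyc_perm a b : 'S_n := perm (cyc_ord_inj a b).

Lemma cyc_permE a b x : b < n -> cyc_perm a b x = cyc a b x :> nat.
Proof. by move=> bn; rewrite permE /=; congr cyc; lia. Qed.

End CycPerm.

(** The parameters can be read off: p is the first moved point and l its image; q is the first place
    where the composite departs from [cyc p l], and its value there is k-1. *)
Lemma cyc2_inj n p q k l p' q' k' l' :
  p < q -> q < k -> k <= l -> l < n ->
  p' < q' -> q' < k' -> k' <= l' -> l' < n ->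
  (forall t, t < n -> cyc p l (cyc q k t) = cyc p' l' (cyc q' k' t)) ->
  [/\ p = p', q = q', k = k' & l = l'].
Proof.
move=> pq qk kl ln pq' qk' kl' ln' E.
have ep : p = p' by have := E p; have := E p'; cyc_lia.
subst p'.
have el : l = l' by have := E p; cyc_lia.
subst l'.
have eq : q = q' by have := E q; have := E q'; cyc_lia.
subst q'.
by split=> //; have := E q; cyc_lia.
Qed.

(** Products of permutations act left to right, so the cycle on q, k is applied first. The last
    entry stands for l+1, hence the predecessor. *)
Definition cyc2_perm n (t : seq nat) : 'S_n :=
  (cyc_perm n (nth 0 t 1) (nth 0 t 2) *
   cyc_perm n (nth 0 t 0) (nth 0 t 3).-1)%g.

Lemma natfun_cyc2_perm n p q k l t : k <= l -> l < n -> t < n ->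
  natfun n (cyc2_perm n [:: p; q; k; l.+1]) t = cyc p l (cyc q k t).
Proof.
move=> kl ln tn; rewrite (natfunE _ _ (Ordinal tn)) permM.
by rewrite !cyc_permE /=; [|lia|lia].
Qed.

Lemma sorted_tuple4P n (t : 4.-tuple 'I_n.+1) : sorted ltn (map val t) ->
  exists p q k l, [/\ p < q, q < k, k <= l, l < n &
    map val t = [:: p; q; k; l.+1]].
Proof.
case: t => -[|[p pn] [|[q qn] [|[k kn] [|[[|l] ln] [|? ?]]]]] //= _ H.
  by lia.
by exists p, q, k, l; split=> //; lia.
Qed.

Theorem theorem5 (n : nat) (hn : 3 <= n) :
  #|[set s : 'S_n | [&& avoids231 s, maxdrop s == 2 & des s == 2]]| = 'C(n.+1, 4).
Proof.
rewrite -card_ltn_sorted_tuples.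
(* The image of the increasing 4-tuples is identified first; injectivity on them comes last. *)
rewrite -(card_in_imset (f := fun t : 4.-tuple 'I_n.+1 =>
  cyc2_perm n (map val t))).
  apply: eq_card => s; rewrite inE; apply/idP/imsetP => [|[t]].
    case/two_descents_maxdrop2_params => p [q [k [l [pq qk kl ln sE]]]].
    pose t := [tuple inord p; inord q; inord k; inord l.+1] : 4.-tuple 'I_n.+1.
    have tE : map val t = [:: p; q; k; l.+1] by rewrite /= !inordK //; lia.
    exists t; first by rewrite inE tE /=; lia.
    apply/permP => x; apply: val_inj.
    by rewrite -[LHS]natfunE -[RHS]natfunE tE natfun_cyc2_perm // sE.
  rewrite inE => /sorted_tuple4P[p [q [k [l [pq qk kl ln ->]]]]] ->.
  apply: (two_descents_maxdrop2_of_params _ _ _ _ _ _ pq qk kl ln) => t' tn.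
  exact: natfun_cyc2_perm.
move=> t t'; rewrite !inE.
move=> /sorted_tuple4P[p [q [k [l [pq qk kl ln tE]]]]].
move=> /sorted_tuple4P[p' [q' [k' [l' [pq' qk' kl' ln' tE']]]]].
rewrite /= tE tE' => E.
apply/val_inj/(inj_map val_inj); rewrite /= tE tE'.
have cycE u : u < n -> cyc p l (cyc q k u) = cyc p' l' (cyc q' k' u).
  move=> un; rewrite -(natfun_cyc2_perm n) //.
  by rewrite -(natfun_cyc2_perm n p') // E.
by have [-> -> -> ->] := cyc2_inj _ _ _ _ _ _ _ _ _
  pq qk kl ln pq' qk' kl' ln' cycE.
Qed.
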